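(* Let $\alpha\in(0,1)$, $\mu>0$ and, for $h\ge1$, $q_h=(1+(1-\alpha^h)\mu)^{-1}$. Let $\{X_t\}$ be a stationary INAR(1) process with prespecified $NB(1,\mu)$ marginal distribution and $NB(1,(1-\alpha)\mu)$ innovation distribution (driven by the thinning operator $(\alpha,\mu)\star(\cdot)$). Then for every $h\ge1$ and all $i,j\ge0$, the $h$-th order transition probability $p_{ij}^{(h)}=P(X_{t+h}=j\mid X_t=i)$ is $$p_{ij}^{(h)}=\begin{cases} q_h(1-q_h)^j & \text{if } i=0,\\[4pt] \displaystyle A_0^{(i)}(\alpha^hq_h)B_1^{(j+1)}(q_h)+\sum_{k=1}^{j}B_1^{(j-k+1)}(q_h)\sum_{l=1}^{\min(i,k)}A_l^{(i)}(\alpha^hq_h)B_l^{(k)}(q_h) & \text{if } i\ge1.\end{cases}$$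
   Context: $\mathbb{Z}_+=\{0,1,2,\dots\}$; pgf means probability generating function. For $r,m>0$, $NB(r,m)$ is the distribution on $\mathbb{Z}_+$ with pgf $(1+m r^{-1}(1-s))^{-r}$ (its mean is $m$). For $\alpha\in(0,1)$ and $\mu>0$, the thinning operator $(\alpha,\mu)\star(\cdot)$ acts on a $\mathbb{Z}_+$-valued random variable $X$ by $(\alpha,\mu)\star X=\sum_{i=1}^{X}G_i$, where $(G_i)_{i\ge1}$ is i.i.d., $\mathbb{Z}_+$-valued, independent of $X$, with pgf $$\Psi_G(s)=1-\alpha\frac{1-s}{1+(1-\alpha)\mu(1-s)}.$$ The INAR(1) process is the $\mathbb{Z}_+$-valued process satisfying $X_{t+1}=(\alpha,\mu)\star X_t+\varepsilon_{t+1}$, $t\ge0$, where the innovations $(\varepsilon_t)$ are i.i.d. and independent of the counting variables $G_i$ (a Galton–Watson branching process with immigration: fresh copies of the $G_i$ are used at each time, and these and $\varepsilon_{t+1}$ are independent of $X_0,\dots,X_t$). Here $\varepsilon_t\sim NB(1,(1-\alpha)\mu)$, and stationarity is achieved by $X_0\sim NB(1,\mu)$. For $n\ge1$, $0\le i\le n$, $1\le l\le n$ and $0<y<1$, $$A_i^{(n)}(y)=\binom{n}{i}y^i(1-y)^{n-i},\qquad B_l^{(n)}(y)=\binom{n-1}{l-1}y^l(1-y)^{n-l}.$$ Empty sums are $0$. *)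

(* Defs.v *)
From HB Require Import structures.
From mathcomp Require Import all_boot all_order all_algebra.
From mathcomp Require Import all_classical all_reals all_analysis.

Set Implicit Arguments.
Unset Strict Implicit.
Unset Printing Implicit Defensive.
Import Order.TTheory GRing.Theory Num.Theory.
Import numFieldNormedType.Exports.
Local Open Scope classical_set_scope.
Local Open Scope ring_scope.

Section Probability.
Context d (T : measurableType d) (R : realType) (P : probability T R).

(* Meaningful when P B > 0; equal to 0 when P B = 0. *)
Definition cond_prob (A B : set T) : R := fine (P (A `&` B)) / fine (P B).

Definition pgf (X : T -> nat) (s : R) : \bar R := ('E_P[fun w => (s ^+ X w)%R])%E.

(* A law on the nonnegative integers is determined by its pgf on [0, 1]. *)
Definition has_pgf (X : T -> nat) (psi : R -> R) : Prop :=
  forall s : R, 0 <= s <= 1 -> pgf X s = (psi s)%:E.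

Definition mutually_independent d' (S : measurableType d') (I : eqType)
    (Z : I -> {RV P >-> S}) : Prop :=
  forall (J : seq I) (A : I -> set S), uniq J ->
    (forall i, i \in J -> measurable (A i)) ->
    P (\bigcap_(i in [set` J]) (Z i @^-1` A i)) =
    (\prod_(i <- J) P (Z i @^-1` A i))%E.

Definition generated_sigma_algebra d' (S : measurableType d') (I : Type)
    (Z : I -> {RV P >-> S}) : set (set T) :=
  <<s \bigcup_(i in [set: I]) preimage_set_system setT (Z i) measurable >>.

Definition independent_families d' (S : measurableType d') (I J : Type)
    (Y : I -> {RV P >-> S}) (Z : J -> {RV P >-> S}) : Prop :=
  forall E F : set T, generated_sigma_algebra Y E ->
    generated_sigma_algebra Z F -> P (E `&` F) = (P E * P F)%E.

End Probability.

Section INAR.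
Context (R : realType).

Definition NB_pgf (r m s : R) : R := (1 + m * r^-1 * (1 - s)) `^ (- r).

Definition thinning_pgf (alpha mu s : R) : R :=
  1 - alpha * ((1 - s) / (1 + (1 - alpha) * mu * (1 - s))).

(* The counting variables are indexed from 0 instead of 1. *)
Definition thinning (T : Type) (G : nat -> T -> nat) (X : T -> nat) (w : T)
  : nat := (\sum_(i < X w) G i w)%N.

Context d (T : measurableType d) (P : probability T R).

(* The randomness entering the step from time t to time t.+1: the counting
   variables G t 0, G t 1, ... and the innovation eps t.+1. *)
Definition step_noise (G : nat -> nat -> {RV P >-> nat})
    (eps : nat -> {RV P >-> nat}) (t : nat) (k : option nat)
  : {RV P >-> nat} := if k is Some i then G t i else eps t.+1.

(* eps 0 plays no role and is left unconstrained. *)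
Record INAR1 (alpha mu : R) (innovation_pgf : R -> R)
    (X : nat -> {RV P >-> nat}) (G : nat -> nat -> {RV P >-> nat})
    (eps : nat -> {RV P >-> nat}) : Prop := {
  INAR1_recursion : forall t w,
    X t.+1 w = (thinning (fun i => G t i : T -> nat) (X t) w + eps t.+1 w)%N;
  INAR1_counting_law : forall t i,
    has_pgf P (G t i) (thinning_pgf alpha mu);
  INAR1_innovation_law : forall t, has_pgf P (eps t.+1) innovation_pgf;
  INAR1_noise_independent : mutually_independent
    (fun u : nat * option nat => step_noise G eps u.1 u.2);
  INAR1_past_independent : forall t, independent_families
    (fun s : 'I_t.+1 => X s) (step_noise G eps t)
}.

Definition transition_prob (X : nat -> {RV P >-> nat}) (t h i j : nat) : R :=
  cond_prob P (X (t + h)%N @^-1` [set j]) (X t @^-1` [set i]).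

Definition A_coef (n i : nat) (y : R) : R :=
  'C(n, i)%:R * y ^+ i * (1 - y) ^+ (n - i).

(* Used only for 1 <= l <= n. *)
Definition B_coef (n l : nat) (y : R) : R :=
  'C(n.-1, l.-1)%:R * y ^+ l * (1 - y) ^+ (n - l).

Definition q_par (alpha mu : R) (h : nat) : R :=
  (1 + (1 - alpha ^+ h) * mu)^-1.

End INAR.

(* Main.v *)
(* Conditionally on X_t = i, X_{t+h} has pgf Psi_h(s)^i Phi_h(s), where Psi_h is
   the h-th iterate of the thinning pgf Psi and Phi_h is the product of the
   Phi o Psi_k, k < h, with Phi the innovation pgf. The maps Psi form a
   multiplicative semigroup in alpha, so Psi_h is Psi with alpha replaced by
   alpha^h and Phi_h(s) = 1 / (1 + (1 - alpha^h) mu (1 - s)). In terms of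
   q = q_h and y = alpha^h q this gives
     Psi_h(s) = 1 - y + y q s / (1 - (1 - q) s),
     Phi_h(s) = q / (1 - (1 - q) s).
   Expanding the i-th power, the coefficient of s^j is
     sum_l A_l^(i)(y) C(j, l) q^(l+1) (1 - q)^(j-l),
   which is the double sum of the statement by the hockey-stick identity.
   The conditioning makes sense because X_t ~ NB(1, mu) charges every i. *)
Require Import Defs.
From HB Require Import structures.
From mathcomp Require Import all_boot all_order all_algebra.
From mathcomp Require Import all_classical all_reals all_analysis.
From mathcomp Require Import measurable_realfun.
From mathcomp Require Import ring lra zify.
Import Order.TTheory GRing.Theory Num.Theory.
Import numFieldNormedType.Exports.
Local Open Scope classical_set_scope.
Local Open Scope ring_scope.

Set Implicit Arguments.
Unset Strict Implicit.

(** * Uniqueness of power series coefficients, and the binomial series *)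

Section PowerSeries.
Variable R : realType.
Implicit Types (a b c : nat -> R) (s x F : R).

(** Every partial sum without its head is at most s M / (1 - s) in absolute value, by comparison
    with a geometric series. Since the full sums tend to 0, this also bounds |c_0|, and s can then
    be taken small. *)
Lemma power_series0_head c (M : R) : (forall n, `|c n| <= M) ->
  (forall s, 0 < s < 1 -> series (fun n => c n * s ^+ n) @ \oo --> (0 : R)) ->
  c 0%N = 0.
Proof.
move=> cM c0; have M0 : 0 <= M by rewrite (le_trans _ (cM 0%N)).
have head_le s : 0 < s < 1 -> `|c 0%N| <= s * (M * (1 - s)^-1).
  move=> s01; have /andP[s0 s1] := s01.
  have lim0 : (fun n => `|series (fun n => c n * s ^+ n) n.+1|) @ \oo --> (0 : R).
    rewrite -(normr0 R); apply: cvg_norm.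
    by rewrite (cvg_shiftS (series (fun n => c n * s ^+ n))); exact: c0.
  rewrite -[leRHS]add0r.
  apply: (@ler_cvg_to _ \oo _ _ (fun=> `|c 0%N|)
    (fun n => `|series (fun n => c n * s ^+ n) n.+1| + s * (M * (1 - s)^-1))).
  - exact: cvg_cst.
  - by apply: cvgD => //; exact: cvg_cst.
  - apply: nearW => n; rewrite seriesEnat/= big_nat_recl//= expr0 mulr1.
    set S := \sum_(0 <= i < n) _.
    have SM : `|S| <= s * (M * (1 - s)^-1).
      rewrite (_ : S = s * \sum_(0 <= i < n) c i.+1 * s ^+ i); last first.
        by rewrite mulr_sumr; apply: eq_bigr => i _; rewrite exprS mulrCA.
      rewrite normrM gtr0_norm// ler_pM2l//.
      apply: (le_trans (ler_norm_sum _ _ _)).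
      apply: (@le_trans _ _ (\sum_(0 <= i < n) M * s ^+ i)).
        apply: ler_sum => i _; rewrite normrM normrX (gtr0_norm s0).
        by rewrite ler_wpM2r// exprn_ge0// ltW.
      have -> : \sum_(0 <= i < n) M * s ^+ i = series (geometric M s) n by [].
      rewrite geometric_seriesE ?lt_eqF// ler_wpM2r//.
        by rewrite invr_ge0 subr_ge0 ltW.
      by rewrite ler_piMr// gerBl exprn_ge0// ltW.
    by rewrite (le_trans _ (lerD (lexx _) SM))// -lerBlDr lerB_normD.
apply/eqP; rewrite -normr_le0; apply/ler_addgt0Pr => e e0; rewrite add0r.
(* s <= 1/2 gives 1 / (1 - s) <= 2, so the bound is at most 2 s M <= e. The [+ 1] keeps the
   denominator positive when M = 0. *)
pose s : R := Num.min (2^-1) (e / (2 * (M + 1))).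
have M1 : 0 < M + 1 by lra.
have s0 : 0 < s by rewrite lt_min; apply/andP; split; [lra|apply: divr_gt0; lra].
have s2 : s <= 2^-1 by rewrite ge_min lexx.
have se : s * (2 * (M + 1)) <= e by rewrite -ler_pdivlMr ?ge_min ?lexx ?orbT//; lra.
apply: (le_trans (head_le s _)); first by apply/andP; split; lra.
apply: le_trans se; rewrite ler_pM2l// ler_pdivrMr; last lra.
by nra.
Qed.

(** Once c_0 = 0, dividing the series by s gives the series of the shifted coefficients, which
    satisfies the same hypotheses with the same M. *)
Lemma power_series0 c (M : R) : (forall n, `|c n| <= M) ->
  (forall s, 0 < s < 1 -> series (fun n => c n * s ^+ n) @ \oo --> (0 : R)) ->
  forall n, c n = 0.
Proof.
move=> cM c0 n; elim: n => [|n IH] in c cM c0 *; first exact: power_series0_head c0.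
have c00 : c 0%N = 0 by exact: power_series0_head c0.
apply: (IH (fun n => c n.+1)) => // s s01; have /andP[s0 _] := s01.
rewrite (_ : series _ =
  (fun n => s^-1 * [sequence series (fun n => c n * s ^+ n) n.+1]_n n)); last first.
  apply/funext => k /=; rewrite !seriesEnat/= big_nat_recl//= c00 mul0r add0r mulr_sumr.
  by apply: eq_bigr => i _; rewrite exprS mulrCA mulKf ?gt_eqF.
rewrite -(mulr0 s^-1); apply: cvgM; first exact: cvg_cst.
rewrite (cvg_shiftS (series (fun n => c n * s ^+ n))); exact: c0.
Qed.

Lemma power_series_unique a b (F : R -> R) :
  (forall s, 0 < s <= 1 -> series (fun n => a n * s ^+ n) @ \oo --> F s) ->
  (forall s, 0 < s <= 1 -> series (fun n => b n * s ^+ n) @ \oo --> F s) ->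
  a =1 b.
Proof.
move=> aF bF n; apply/eqP; rewrite -subr_eq0; apply/eqP.
have cF s : 0 < s <= 1 -> series (fun n => (a n - b n) * s ^+ n) @ \oo --> (0 : R).
  move=> s01; rewrite -(subrr (F s)).
  rewrite (_ : series _ =
    series (fun n => a n * s ^+ n) - series (fun n => b n * s ^+ n)).
    by apply: cvgB; [exact: aF|exact: bF].
  apply/funext => k; rewrite !fctE !seriesEnat/= -sumrB.
  by apply: eq_bigr => i _; rewrite mulrBl.
(* Convergence at the endpoint s = 1 forces the terms, here the coefficients themselves, to be
   bounded. *)
have [M cM] : exists M, forall n, `|a n - b n| <= M.
  have := cF 1; rewrite ltr01 lexx => /(_ isT) c1.
  have /cvg_series_bounded : cvgn (series (fun n => (a n - b n) * 1 ^+ n)).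
    by apply/cvg_ex; exists 0.
  move=> [M [_ /(_ (M + 1)) Mc]]; exists (M + 1) => k.
  have /Mc/(_ k I) : M < M + 1 by rewrite ltrDl.
  by rewrite /= expr1n mulr1.
apply: (@power_series0 (fun n => a n - b n) M cM) => s /andP[s0 s1].
by apply: cF; rewrite s0 ltW.
Qed.

(** Induction on l: Pascal's rule links the partial sums by v_(n+1) = x u_n + x v_n. As v is
    nondecreasing, (1 - x) v_n <= x u_n <= x lim u, so v converges, and its limit solves L = x lim u
    + x L. *)
Lemma cvg_series_bin (l : nat) x : 0 <= x < 1 ->
  series (fun n => 'C(n, l)%:R * x ^+ n) @ \oo --> x ^+ l / (1 - x) ^+ l.+1.
Proof.
move=> /andP[x0 x1]; have x1' : 0 < 1 - x by rewrite subr_gt0.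
elim: l => [|l IH].
  rewrite expr0 expr1; under eq_fun do rewrite bin0; apply: cvg_geometric_series.
  by rewrite ger0_norm.
set u := series (fun n => 'C(n, l)%:R * x ^+ n) in IH *.
set v := series (fun n => 'C(n, l.+1)%:R * x ^+ n).
have vS n : v n.+1 = x * u n + x * v n.
  rewrite /v /u !seriesEnat/= big_nat_recl//= bin0n mul0r add0r !mulr_sumr -big_split/=.
  by apply: eq_bigr => i _; rewrite binS natrD exprS; ring.
have u_nd : nondecreasing_seq u.
  by apply: nondecreasing_series => n _ _; rewrite mulr_ge0 ?ler0n ?exprn_ge0.
have v_nd : nondecreasing_seq v.
  by apply: nondecreasing_series => n _ _; rewrite mulr_ge0 ?ler0n ?exprn_ge0.
have vcvg : cvgn v.
  apply: nondecreasing_is_cvgn => //.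
  exists (x * (x ^+ l / (1 - x) ^+ l.+1) / (1 - x)) => _ [n _ <-].
  rewrite ler_pdivlMr//.
  have un : u n <= x ^+ l / (1 - x) ^+ l.+1.
    rewrite -(cvg_lim _ IH)//; apply: nondecreasing_cvgn_le => //.
    by apply/cvg_ex; eexists; exact: IH.
  have := v_nd n n.+1 (leqnSn n); rewrite vS => vn.
  by have := ler_wpM2l x0 un; lra.
have /cvg_ex[/= L vL] := vcvg.
suff <- : L = x ^+ l.+1 / (1 - x) ^+ l.+2 by [].
have LE : L = x * (x ^+ l / (1 - x) ^+ l.+1) + x * L.
  have vSL : [sequence v n.+1]_n @ \oo --> L by rewrite (cvg_shiftS v).
  apply: (cvg_unique (@norm_hausdorff _ _) vSL).
  rewrite (_ : [sequence v n.+1]_n = fun n => x * u n + x * v n); last exact/funext.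
  by apply: cvgD; apply: cvgM => //; exact: cvg_cst.
have -> : L = x * (x ^+ l / (1 - x) ^+ l.+1) / (1 - x).
  by rewrite (_ : x * _ = L * (1 - x)) ?mulfK ?gt_eqF//; lra.
have x1n : 1 - x != 0 by rewrite gt_eqF.
by rewrite !exprS; field; rewrite x1n expf_neq0.
Qed.

End PowerSeries.

(** * The transition coefficients and their generating function *)

Section TransitionCoefficients.
Variable R : realType.
Implicit Types (y q s : R) (i j k l : nat).

(** For y and q in (0, 1), a binomial mixture of negative binomial laws: with l drawn from
    Binomial(i, y), the weight of j is the probability that l geometric variables on {1, 2, ...} and
    one on {0, 1, ...}, independent and of parameter q, sum to j. *)
Definition mixed_coef i j y q : R :=
  \sum_(0 <= l < i.+1) A_coef i l y * ('C(j, l)%:R * q ^+ l.+1 * (1 - q) ^+ (j - l)).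

Lemma mixed_coef0 j y q : mixed_coef 0 j y q = q * (1 - q) ^+ j.
Proof. by rewrite /mixed_coef big_nat1 /A_coef !bin0 !subn0 !expr0 !mul1r expr1. Qed.

Lemma hockey_stick l j : (\sum_(1 <= k < j.+1) 'C(k.-1, l) = 'C(j, l.+1))%N.
Proof.
elim: j => [|j IH]; first by rewrite big_geq.
by rewrite big_nat_recr//= IH binS.
Qed.

Lemma B_coef_small k l q : (0 < k)%N -> (k < l)%N -> B_coef k l q = 0.
Proof. by move=> k0 kl; rewrite /B_coef bin_small ?mul0r//; lia. Qed.

(** For l <= k <= j the powers of q and 1 - q in the product do not depend on k, so only the
    binomials 'C(k - 1, l - 1) are summed, by [hockey_stick]. *)
Lemma B_coef_convolution j l q : (0 < l)%N ->
  \sum_(1 <= k < j.+1) B_coef (j - k).+1 1 q * B_coef k l q =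
  'C(j, l)%:R * q ^+ l.+1 * (1 - q) ^+ (j - l).
Proof.
case: l => // l _; rewrite -hockey_stick natr_sum !mulr_suml.
apply: eq_big_nat => k /andP[k0 kj].
(* Both sides vanish when k is below the second index; otherwise the truncated subtractions are
   genuine and the exponents of 1 - q add up. *)
have [kl|lk] := ltnP k l.+1.
  by rewrite [B_coef k _ _]B_coef_small// bin_small ?mulr0 ?mul0r//; lia.
rewrite /B_coef /= bin0 mul1r expr1 subn1 /=.
rewrite (_ : (j - l.+1 = (j - k) + (k - l.+1))%N); last by lia.
by rewrite exprD [in RHS]exprS; ring.
Qed.

Lemma mixed_coefE i j y q :
  A_coef i 0 y * B_coef j.+1 1 q +
    \sum_(1 <= k < j.+1) B_coef (j - k).+1 1 q *
      \sum_(1 <= l < (minn i k).+1) A_coef i l y * B_coef k l q =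
  mixed_coef i j y q.
Proof.
rewrite /mixed_coef [in RHS]big_ltn//; congr (_ + _).
transitivity (\sum_(1 <= k < j.+1) \sum_(1 <= l < i.+1)
    A_coef i l y * (B_coef (j - k).+1 1 q * B_coef k l q)).
  apply: eq_big_nat => k /andP[k0 _].
  (* The inner range is widened to l <= i, where the added terms have l > k and vanish. It is then
     independent of k and the sums can be exchanged. *)
  rewrite (@big_nat_widen _ _ _ _ _ i.+1); last by rewrite ltnS geq_minl.
  rewrite big_mkcond mulr_sumr; apply: eq_big_nat => l /andP[l0 li].
  case: ifPn => [_|]; first by rewrite mulrCA.
  by rewrite -leqNgt => kl; rewrite [B_coef k l q]B_coef_small ?mulr0//; lia.
rewrite exchange_big_nat; apply: eq_big_nat => l /andP[l0 _].
by rewrite -mulr_sumr B_coef_convolution.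
Qed.

Lemma cvg_series_mixed_coef i y q s : 0 < q < 1 -> 0 < s <= 1 ->
  series (fun j => mixed_coef i j y q * s ^+ j) @ \oo -->
  (1 - y + y * (q * s / (1 - (1 - q) * s))) ^+ i * (q / (1 - (1 - q) * s)).
Proof.
move=> /andP[q0 q1] /andP[s0 s1].
set r := 1 - q; set D := 1 - r * s.
have r0 : 0 < r by rewrite subr_gt0.
have rs1 : 0 <= r * s < 1 by apply/andP; split; rewrite /r; nra.
have D0 : D != 0 by rewrite gt_eqF// subr_gt0; case/andP: rs1.
(* With r = 1 - q, r^(j-l) s^j = r^(-l) (r s)^j for j >= l, and the binomial is 0 for j < l. Each l
   thus contributes a multiple of the binomial series at r s; the limits are reassembled by the
   binomial theorem. *)
rewrite (_ : series _ = fun n => \sum_(0 <= l < i.+1) A_coef i l y *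
    (q ^+ l.+1 / r ^+ l * series (fun j => 'C(j, l)%:R * (r * s) ^+ j) n)); last first.
  apply/funext => n; rewrite seriesEnat/=.
  under eq_bigr do rewrite /mixed_coef mulr_suml.
  rewrite exchange_big_nat; apply: eq_big_nat => l _.
  rewrite seriesEnat/= !mulr_sumr; apply: eq_big_nat => j _.
  have [jl|lj] := ltnP j l; first by rewrite bin_small//; ring.
  rewrite -/r exprMn (_ : r ^+ j = r ^+ (j - l) * r ^+ l); last by rewrite -exprD subnK.
  by field; rewrite expf_neq0// gt_eqF.
rewrite (_ : _ ^+ i * (q / D) = \sum_(0 <= l < i.+1) A_coef i l y *
    (q ^+ l.+1 / r ^+ l * ((r * s) ^+ l / (1 - r * s) ^+ l.+1))); last first.
  rewrite exprDn mulr_suml big_mkord; apply: eq_bigr => l _.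
  rewrite -/r -/D /A_coef -mulr_natr !exprMn !exprS exprVn.
  by field; rewrite D0 !expf_neq0// gt_eqF.
apply: cvg_big => [|l _]; first exact: add_continuous.
by apply: cvgM; [exact: cvg_cst|apply: cvgM; [exact: cvg_cst|exact: cvg_series_bin]].
Qed.

End TransitionCoefficients.

(** * Integrals over events of functions of integer-valued variables *)

Section NatValued.
Context d (T : measurableType d) (R : realType) (P : probability T R).
Local Open Scope ereal_scope.
Implicit Types (E : set T) (N : {RV P >-> nat}) (s : R).

Lemma measurable_nat_preimage N (A : set nat) : measurable (N @^-1` A).
Proof. by rewrite -[X in measurable X]setTI; exact: measurable_funPT. Qed.

Lemma measurable_fun_nat_comp N (f : nat -> R) D :
  measurable_fun D (fun w => f (N w)).
Proof.
apply: (@measurable_funS _ _ _ _ setT) => // _ Y mY.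
by rewrite setTI; exact: (measurable_nat_preimage N (f @^-1` Y)).
Qed.

Lemma integral_fibers E N (f : T -> \bar R) : measurable E ->
  measurable_fun setT f -> (forall w, 0 <= f w) ->
  \int[P]_(w in E) f w = \sum_(n <oo) \int[P]_(w in E `&` N @^-1` [set n]) f w.
Proof.
move=> mE mf f0.
have EU : E = \bigcup_n (E `&` N @^-1` [set n]).
  by apply/seteqP; split => [w Ew|w [n _ []//]]; exists (N w).
rewrite {1}EU ge0_integral_bigcup//.
- by move=> n; apply: measurableI => //; exact: measurable_nat_preimage.
- exact: measurable_funS mf.
- by move=> n m _ _ [w [[_ <-] [_ <-]]].
Qed.

Lemma integral_nat E N (f : nat -> R) : measurable E -> (forall n, (0 <= f n)%R) ->
  \int[P]_(w in E) (f (N w))%:E =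
  \sum_(n <oo) (f n)%:E * P (E `&` N @^-1` [set n]).
Proof.
move=> mE f0; rewrite (@integral_fibers E N)//; last 2 first.
- by apply/measurable_EFinP; exact: measurable_fun_nat_comp.
- by move=> w; rewrite lee_fin.
apply: eq_eseriesr => n _.
rewrite -integral_cst; last by apply: measurableI => //; exact: measurable_nat_preimage.
by apply: eq_integral => w /set_mem[_ /= ->].
Qed.

Lemma pgf_nat N s : (0 <= s)%R ->
  pgf P N s = \sum_(n <oo) (s ^+ n)%:E * P (N @^-1` [set n]).
Proof.
move=> s0; rewrite /pgf unlock (@integral_nat setT N (fun n => s ^+ n)%R)//.
  by apply: eq_eseriesr => n _; rewrite setTI.
by move=> n; exact: exprn_ge0.
Qed.

(* Peeling off one variable at a time turns its value into a new cylinder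
   condition, so the independence hypothesis on cylinders is all that is used. *)
Lemma integral_prod_indep (I : eqType) (Z : I -> {RV P >-> nat}) E
    (phi : I -> R -> R) s (J K : seq I) (A : I -> set nat) :
  measurable E ->
  (forall (L : seq I) (B : I -> set nat), uniq L ->
    P (E `&` \bigcap_(i in [set` L]) (Z i @^-1` B i)) =
    P E * \prod_(i <- L) P (Z i @^-1` B i)) ->
  (forall i, has_pgf P (Z i) (phi i)) -> (0 <= s <= 1)%R -> uniq (J ++ K) ->
  \int[P]_(w in E `&` \bigcap_(i in [set` K]) (Z i @^-1` A i))
    (\prod_(u <- J) s ^+ Z u w)%:E =
  P E * \prod_(i <- K) P (Z i @^-1` A i) * (\prod_(u <- J) phi u s)%:E.
Proof.
move=> mE indepE pgfZ s01; have s0 : (0 <= s)%R by case/andP: s01.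
have mC (L : seq I) (B : I -> set nat) :
    measurable (E `&` \bigcap_(i in [set` L]) (Z i @^-1` B i)).
  apply: measurableI => //; apply: fin_bigcap_measurable.
    exact: finite_seq.
  by move=> i _; exact: measurable_nat_preimage.
elim: J => [|u J IH] in K A *.
  move=> uK; under eq_integral do rewrite big_nil.
  by rewrite integral_cst// mul1e big_nil mule1; exact: indepE.
rewrite cons_uniq mem_cat negb_or -andbA => /and3P[uJ uK uniqJK].
rewrite (@integral_fibers _ (Z u))//; last 2 first.
- apply/measurable_EFinP; apply: measurable_prod => i _.
  exact: (measurable_fun_nat_comp (Z i) (fun n => s ^+ n)%R).
- by move=> w; rewrite lee_fin; apply: prodr_ge0 => i _; exact: exprn_ge0.
transitivity (\sum_(n <oo) (P E * \prod_(i <- K) P (Z i @^-1` A i) *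
    (\prod_(u <- J) phi u s)%:E) * ((s ^+ n)%:E * P (Z u @^-1` [set n]))).
  apply: eq_eseriesr => n _.
  (* The condition Z_u = n joins the cylinder. As u is not in [K], overriding [A] at u leaves the
     earlier conditions intact. *)
  pose B i := if i == u then [set n] else A i.
  have BK i : i \in K -> B i = A i.
    by move=> iK; rewrite /B; case: eqP => // iu; rewrite -iu iK in uK.
  have -> : E `&` \bigcap_(i in [set` K]) (Z i @^-1` A i) `&` Z u @^-1` [set n] =
      E `&` \bigcap_(i in [set` u :: K]) (Z i @^-1` B i).
    rewrite -setIA; congr (_ `&` _); apply/seteqP; split => w.
    - move=> [wK wu] i /=; rewrite inE => /orP[/eqP->|iK]; first by rewrite /B eqxx.
      by rewrite (BK _ iK); exact: wK.
    - move=> wB; split; last by have := wB u; rewrite /= /B eqxx; apply; rewrite mem_head.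
      by move=> i /= iK; rewrite -(BK _ iK); apply: wB; rewrite /= inE iK orbT.
  transitivity (\int[P]_(w in E `&` \bigcap_(i in [set` u :: K]) (Z i @^-1` B i))
      ((s ^+ n)%:E * (\prod_(v <- J) s ^+ Z v w)%:E)).
    apply: eq_integral => w /set_mem[_ wB]; rewrite big_cons EFinM.
    by have := wB u (mem_head _ _); rewrite /= /B eqxx => ->.
  rewrite ge0_integralZl//; last 3 first.
  - apply: (@measurable_funS _ _ _ _ setT) => //.
    apply/measurable_EFinP; apply: measurable_prod => i _.
    exact: (measurable_fun_nat_comp (Z i) (fun n => s ^+ n)%R).
  - by move=> w _; rewrite lee_fin; apply: prodr_ge0 => i _; exact: exprn_ge0.
  - by rewrite lee_fin exprn_ge0.
  rewrite IH; last by rewrite -cat1s uniq_catCA /= mem_cat negb_or uJ uK.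
  rewrite big_cons {1}/B eqxx.
  rewrite (eq_big_seq (fun i => P (Z i @^-1` A i))); last by move=> i /BK ->.
  by rewrite [RHS]muleC -!muleA; congr (_ * _); rewrite muleCA.
rewrite -[X in X * _]fineK; last first.
  by rewrite !fin_numM// ?fin_num_measure//; apply: prode_fin_num => i _;
    rewrite fin_num_measure//; exact: measurable_nat_preimage.
rewrite nneseriesZl; last by move=> n _; rewrite mule_ge0// lee_fin exprn_ge0.
rewrite -pgf_nat// pgfZ// big_cons EFinM fineK; last first.
  by rewrite !fin_numM// ?fin_num_measure//; apply: prode_fin_num => i _;
    rewrite fin_num_measure//; exact: measurable_nat_preimage.
by rewrite -!muleA; do 2 congr (_ * _); rewrite muleC.
Qed.

End NatValued.

(** * Events generated by a family of integer-valued variables *)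

Section GeneratedSigmaAlgebra.
Context d (T : measurableType d) (R : realType) (P : probability T R).
Context (I : Type) (Z : I -> {RV P >-> nat}).
Local Notation sigmaZ := (generated_sigma_algebra Z).

Lemma generated_sigma_algebra_setT : sigmaZ setT.
Proof.
rewrite -(setD0 setT).
have [s0 sC _] := smallest_sigma_algebra setT
  (\bigcup_(i in [set: I]) preimage_set_system setT (Z i) measurable).
exact: sC.
Qed.

Lemma generated_sigma_algebra_setI : setI_closed sigmaZ.
Proof.
by have [] := (sigma_algebraP (fun _ _ => @subsetT _ _)).1
  (smallest_sigma_algebra setT
    (\bigcup_(i in [set: I]) preimage_set_system setT (Z i) measurable)).
Qed.

Lemma generated_sigma_algebra_preimage i (A : set nat) : sigmaZ (Z i @^-1` A).
Proof. by apply: sub_sigma_algebra; exists i => //; exists A; rewrite ?setTI. Qed.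

Lemma generated_sigma_algebra_measurable : sigmaZ `<=` measurable.
Proof.
apply: smallest_sub; first exact: sigma_algebra_measurable.
by move=> _ [i _ [A _ <-]]; rewrite setTI; exact: measurable_nat_preimage.
Qed.

End GeneratedSigmaAlgebra.

Lemma generated_sigma_algebra_bigcap d (T : measurableType d) (R : realType)
    (P : probability T R) (I : eqType) (Z : I -> {RV P >-> nat}) (L : seq I)
    (B : I -> set nat) :
  generated_sigma_algebra Z (\bigcap_(i in [set` L]) (Z i @^-1` B i)).
Proof.
elim: L => [|i L IH].
  by rewrite set_nil bigcap_set0; exact: generated_sigma_algebra_setT.
have -> : [set` i :: L] = i |` [set` L].
  by apply/seteqP; split => x /= /predU1P.
rewrite bigcap_setU1; apply: generated_sigma_algebra_setI => //.
exact: generated_sigma_algebra_preimage.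
Qed.

(** * Composition rules for the thinning and innovation pgfs *)

Section ThinningSemigroup.
Variables (R : realType) (mu : R).
Hypothesis hmu : 0 < mu.
Implicit Types a b s : R.

Lemma thinning_pgf_in01 a s : 0 <= a <= 1 -> 0 <= s <= 1 ->
  0 <= thinning_pgf a mu s <= 1.
Proof.
move=> /andP[a0 a1] /andP[s0 s1]; rewrite /thinning_pgf.
have u0 : 0 <= (1 - a) * mu * (1 - s).
  by rewrite !mulr_ge0// ?subr_ge0// ltW.
set v := 1 + (1 - a) * mu * (1 - s); have v0 : 0 < v by rewrite /v; lra.
have v1 : 0 <= (1 - s) / v by rewrite divr_ge0 ?subr_ge0// ltW.
have v2 : (1 - s) / v <= 1 by rewrite ler_pdivrMr// mul1r /v; lra.
by apply/andP; split; nra.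
Qed.

Lemma NB_pgf1 m s : 0 <= m -> 0 <= s <= 1 -> NB_pgf 1 m s = (1 + m * (1 - s))^-1.
Proof.
move=> m0 /andP[s0 s1]; rewrite /NB_pgf invr1 mulr1 powR_inv1//.
by rewrite addr_ge0// mulr_ge0// subr_ge0.
Qed.

Lemma thinning_denominator_gt0 a s : 0 <= a <= 1 -> 0 <= s <= 1 ->
  0 < 1 + (1 - a) * mu * (1 - s).
Proof.
move=> /andP[a0 a1] /andP[s0 s1].
by rewrite ltr_pwDl// !mulr_ge0// ?subr_ge0// ltW.
Qed.

(** For a > 0 and s < 1, the map s -> [thinning_pgf a mu s] multiplies 1 / (1 - s) + mu by 1 / a, so
    composing maps multiplies their parameters. *)
Lemma thinning_pgf_comp a b s : 0 <= a <= 1 -> 0 <= b <= 1 -> 0 <= s <= 1 ->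
  thinning_pgf b mu (thinning_pgf a mu s) = thinning_pgf (b * a) mu s.
Proof.
move=> a01 b01 s01.
have va := thinning_denominator_gt0 a01 s01.
have ba01 : 0 <= b * a <= 1.
  by case/andP: a01 => a0 a1; case/andP: b01 => b0 b1; rewrite mulr_ge0//= mulr_ile1.
have vba := thinning_denominator_gt0 ba01 s01.
rewrite /thinning_pgf; field.
rewrite !gt_eqF//; move: va vba; lra.
Qed.

(** With u = 1 - s and v = 1 + (1 - a) mu u, one has 1 - [thinning_pgf a mu s] = a u / v, so the
    product of the denominators is v + (1 - b) a mu u = 1 + (1 - b a) mu u. *)
Lemma innovation_pgf_comp a b s : 0 <= a <= 1 -> 0 <= b <= 1 -> 0 <= s <= 1 ->
  (1 + (1 - a) * mu * (1 - s))^-1 *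
    (1 + (1 - b) * mu * (1 - thinning_pgf a mu s))^-1 =
  (1 + (1 - b * a) * mu * (1 - s))^-1.
Proof.
move=> a01 b01 s01.
have va := thinning_denominator_gt0 a01 s01.
have ba01 : 0 <= b * a <= 1.
  by case/andP: a01 => a0 a1; case/andP: b01 => b0 b1; rewrite mulr_ge0//= mulr_ile1.
have vba := thinning_denominator_gt0 ba01 s01.
rewrite -invfM; congr (_^-1); rewrite /thinning_pgf; field.
by rewrite gt_eqF//; move: va; lra.
Qed.

End ThinningSemigroup.

(** * Generating functions along the process *)

Section InarProcess.
Context (R : realType) (d : measure_display) (T : measurableType d)
  (P : probability T R) (alpha mu : R).
Context (X : nat -> {RV P >-> nat}) (G : nat -> nat -> {RV P >-> nat})
  (eps : nat -> {RV P >-> nat}).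
Hypotheses (halpha : 0 < alpha < 1) (hmu : 0 < mu).
Hypothesis hX : INAR1 alpha mu (NB_pgf 1 ((1 - alpha) * mu)) X G eps.

Let mu_alpha_ge0 : 0 <= (1 - alpha) * mu.
Proof. by case/andP: halpha => _ a1; apply: mulr_ge0; [lra|exact: ltW]. Qed.

Let alpha01 : 0 <= alpha <= 1.
Proof. by case/andP: halpha => a0 a1; rewrite !ltW. Qed.

Local Open Scope ereal_scope.

(** Independence of the past from the step's noise splits off E; mutual independence of all the
    noise, restricted to the indices (t, i), splits the cylinder. This is the hypothesis of
    [integral_prod_indep]. *)
Lemma step_noise_cylinder t E (L : seq (option nat)) (B : option nat -> set nat) :
  generated_sigma_algebra (fun s : 'I_t.+1 => X s) E -> uniq L ->
  P (E `&` \bigcap_(i in [set` L]) (step_noise G eps t i @^-1` B i)) =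
  P E * \prod_(i <- L) P (step_noise G eps t i @^-1` B i).
Proof.
move=> XE uL; rewrite (INAR1_past_independent hX XE); last first.
  exact: generated_sigma_algebra_bigcap.
congr (_ * _).
have := @INAR1_noise_independent _ _ _ _ _ _ _ _ _ _ hX (map (pair t) L)
  (fun u => B u.2).
rewrite big_map/= => <-.
- congr (P _); apply/seteqP; split => w /= wB.
  + by move=> _ /= /mapP[i iL ->]; exact: wB.
  + by move=> i iL; apply: (wB (t, i)); rewrite /= map_f.
- by rewrite map_inj_uniq// => i k [].
- by [].
Qed.

(** On the fiber X_t = n, X_(t+1) is the innovation plus n counting variables, all independent of E
    and of the fiber, so the integral factors. Allowing any past event E lets the step be iterated
    under a condition on an earlier time. *)
Lemma INAR1_step t E (s : R) :
  generated_sigma_algebra (fun s : 'I_t.+1 => X s) E -> (0 <= s <= 1)%R ->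
  \int[P]_(w in E) (s ^+ X t.+1 w)%:E =
  (1 + (1 - alpha) * mu * (1 - s))^-1%:E *
    \int[P]_(w in E) (thinning_pgf alpha mu s ^+ X t w)%:E.
Proof.
move=> XE s01; have s0 : (0 <= s)%R by case/andP: s01.
have psi0 : (0 <= thinning_pgf alpha mu s)%R.
  by case/andP: (thinning_pgf_in01 hmu alpha01 s01).
have mE : measurable E by exact: generated_sigma_algebra_measurable XE.
rewrite (@integral_fibers _ _ _ _ _ (X t))//; last 2 first.
- apply/measurable_EFinP.
  exact: (measurable_fun_nat_comp (X t.+1) (fun n => s ^+ n)%R).
- by move=> w; rewrite lee_fin exprn_ge0.
rewrite (@integral_nat _ _ _ _ E (X t)
  (fun n => thinning_pgf alpha mu s ^+ n)%R)//; last first.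
  by move=> n; exact: exprn_ge0.
rewrite -nneseriesZl => [|n _]; last by rewrite mule_ge0// lee_fin exprn_ge0.
apply: eq_eseriesr => n _.
pose phi (i : option nat) := if i is Some _ then thinning_pgf alpha mu
  else NB_pgf 1 ((1 - alpha) * mu).
have XEn : generated_sigma_algebra (fun s : 'I_t.+1 => X s) (E `&` X t @^-1` [set n]).
  apply: generated_sigma_algebra_setI => //.
  exact: (generated_sigma_algebra_preimage (@ord_max t)).
(* [None] is the innovation and [Some i], i < n, are the counting variables in use. The cylinder
   starts empty, hence the trivial intersection over [[::]] below. *)
pose J := None :: map Some (iota 0 n).
transitivity (\int[P]_(w in (E `&` X t @^-1` [set n]) `&`
    \bigcap_(i in [set` [::]]) (step_noise G eps t i @^-1` setT))
    (\prod_(u <- J) s ^+ step_noise G eps t u w)%:E).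
  rewrite set_nil bigcap_set0 setIT; apply: eq_integral => w /set_mem[_ /= Xn].
  rewrite -expr_sum (INAR1_recursion hX) /J big_cons big_map /= addnC.
  by rewrite /thinning Xn -(big_mkord xpredT (fun i => G t i w)) /index_iota subn0.
rewrite (@integral_prod_indep _ _ _ _ _ _ _ phi)//.
- rewrite big_nil mule1 muleC /J big_cons big_map /= big_const_seq.
  rewrite count_predT size_iota iter_mulr_1 EFinM.
  by rewrite NB_pgf1// muleA.
- exact: generated_sigma_algebra_measurable XEn.
- by move=> L B uL; exact: step_noise_cylinder.
- case=> [i|]; first exact: (INAR1_counting_law hX).
  exact: (INAR1_innovation_law hX).
- by rewrite cats0 /= map_inj_uniq ?iota_uniq ?andbT => [|i k []//]; apply/mapP => -[].
Qed.

(** The last step is peeled off: {X_t = i} lies in the past of time t + h, so [INAR1_step] applies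
    and the induction hypothesis is used at [thinning_pgf alpha mu s]. Hence s stays general in the
    induction. *)
Lemma INAR1_joint_pgf t i h (s : R) : (0 <= s <= 1)%R ->
  \int[P]_(w in X t @^-1` [set i]) (s ^+ X (t + h)%N w)%:E =
  P (X t @^-1` [set i]) *
    (thinning_pgf (alpha ^+ h) mu s ^+ i *
     (1 + (1 - alpha ^+ h) * mu * (1 - s))^-1)%:E.
Proof.
elim: h => [|h IH] in s *.
  move=> s01; rewrite addn0 expr0 subrr !mul0r addr0 invr1 mulr1.
  rewrite muleC -integral_cst; last exact: measurable_nat_preimage.
  apply: eq_integral => w /set_mem /= ->.
  by rewrite /thinning_pgf subrr !mul0r addr0 invr1 mulr1 mul1r opprB addrC subrK.
move=> s01; rewrite addnS INAR1_step//; last first.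
  have it : (t < (t + h).+1)%N by rewrite ltnS leq_addr.
  exact: (generated_sigma_algebra_preimage (Ordinal it)).
have ah01 : (0 <= alpha ^+ h <= 1)%R.
  by case/andP: alpha01 => a0 a1; rewrite exprn_ge0// exprn_ile1.
rewrite IH; last exact: thinning_pgf_in01.
rewrite muleCA -EFinM; congr (_ * _%:E).
rewrite mulrCA innovation_pgf_comp// thinning_pgf_comp//.
by rewrite -exprSr.
Qed.

Lemma INAR1_marginal_pgf t (s : R) : has_pgf P (X 0%N) (NB_pgf 1 mu) ->
  (0 <= s <= 1)%R -> pgf P (X t) s = ((1 + mu * (1 - s))^-1)%:E.
Proof.
move=> hX0; elim: t => [|t IH] in s *.
  by move=> s01; rewrite hX0// NB_pgf1// ltW.
move=> s01; have psi01 := thinning_pgf_in01 hmu alpha01 s01.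
have := IH _ psi01; rewrite /pgf unlock INAR1_step//; last first.
  exact: generated_sigma_algebra_setT.
move=> ->; rewrite -EFinM; congr (_%:E).
(* At b = 0 the second factor is the NB(1, mu) pgf at the thinned argument and the right side is
   that pgf at s, which is the invariance of the marginal law. *)
have := @innovation_pgf_comp _ _ hmu alpha 0 s alpha01.
by rewrite mul0r !subr0 mul1r => ->//; rewrite lexx ler01.
Qed.

End InarProcess.

(** * Reading off probabilities from generating functions *)

Section Pmf.
Context d (T : measurableType d) (R : realType) (P : probability T R).

Lemma cvg_series_pmf (E : set T) (N : {RV P >-> nat}) (s F : R) :
  measurable E -> 0 <= s ->
  (\int[P]_(w in E) (s ^+ N w)%:E = F%:E)%E ->
  series (fun n => fine (P (E `&` N @^-1` [set n])) * s ^+ n) @ \oo --> F.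
Proof.
move=> mE s0; rewrite (@integral_nat _ _ _ _ E N (fun n => s ^+ n))//; last first.
  by move=> n; exact: exprn_ge0.
move=> sumF; apply: (@fine_cvg _ _ _ _ (fun n => (series
  (fun n => fine (P (E `&` N @^-1` [set n])) * s ^+ n) n)%:E)).
rewrite -sumF (_ : (fun n => _) = fun n => (\sum_(0 <= k < n) (s ^+ k)%:E *
    P (E `&` N @^-1` [set k]))%E).
  by apply: is_cvg_nneseries => n _ _; rewrite mule_ge0// lee_fin exprn_ge0.
apply/funext => n; rewrite seriesEnat/= -sumEFin; apply: eq_bigr => k _.
rewrite EFinM fineK 1?muleC// fin_num_measure//.
by apply: measurableI => //; exact: measurable_nat_preimage.
Qed.

End Pmf.

(** The explicit geometric weights show that every state is charged at every time. They are the case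
    i = 0 of [mixed_coef], so the same series expansion identifies them. *)
Lemma INAR1_marginal_pmf (R : realType) (d : measure_display)
    (T : measurableType d) (P : probability T R) (alpha mu : R)
    (X : nat -> {RV P >-> nat}) (G : nat -> nat -> {RV P >-> nat})
    (eps : nat -> {RV P >-> nat}) (t i : nat) :
  0 < alpha < 1 -> 0 < mu ->
  INAR1 alpha mu (NB_pgf 1 ((1 - alpha) * mu)) X G eps ->
  has_pgf P (X 0%N) (NB_pgf 1 mu) ->
  fine (P (X t @^-1` [set i])) = (1 + mu)^-1 * (1 - (1 + mu)^-1) ^+ i.
Proof.
move=> halpha hmu hX hX0; set q := (1 + mu)^-1; rewrite -(mixed_coef0 i 0 q).
have q01 : 0 < q < 1.
  have mu1 : 0 < 1 + mu by lra.
  by rewrite /q invr_gt0 mu1 invf_lt1// ltrDl.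
apply: (@power_series_unique _ (fun n => fine (P (X t @^-1` [set n])))
  (fun n => mixed_coef 0 n 0 q) (fun s => (1 + mu * (1 - s))^-1)) => s s01.
- have /andP[s0 s1] := s01; under eq_fun do rewrite -[X t @^-1` _]setTI.
  apply: cvg_series_pmf => //; first exact: ltW.
  have := @INAR1_marginal_pgf _ _ _ _ _ _ _ _ _ halpha hmu hX t s hX0.
  by rewrite /pgf unlock (ltW s0) => ->.
- have /andP[s0 s1] := s01.
  rewrite (_ : (1 + mu * (1 - s))^-1 =
    (1 - 0 + 0 * (q * s / (1 - (1 - q) * s))) ^+ 0 * (q / (1 - (1 - q) * s))).
    exact: cvg_series_mixed_coef.
  have v0 : 0 < 1 + mu * (1 - s) by nra.
  by rewrite expr0 mul1r /q; field; rewrite !gt_eqF//; lra.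
Qed.

(** * The transition probabilities *)

Unset Implicit Arguments.
Set Strict Implicit.

Theorem proposition3p2 (R : realType) (d : measure_display)
    (T : measurableType d) (P : probability T R) (alpha mu : R)
    (X : nat -> {RV P >-> nat}) (G : nat -> nat -> {RV P >-> nat})
    (eps : nat -> {RV P >-> nat})
    (halpha : 0 < alpha < 1) (hmu : 0 < mu)
    (hX : INAR1 alpha mu (NB_pgf 1 ((1 - alpha) * mu)) X G eps)
    (hX0 : has_pgf P (X 0%N) (NB_pgf 1 mu))
    (t h i j : nat) (hh : (1 <= h)%N) :
  let q := q_par alpha mu h in
  let y := alpha ^+ h * q in
  transition_prob X t h i j =
    if i == 0%N then q * (1 - q) ^+ j
    else A_coef i 0 y * B_coef j.+1 1 q +
      \sum_(1 <= k < j.+1) B_coef (j - k).+1 1 q *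
        \sum_(1 <= l < (minn i k).+1) A_coef i l y * B_coef k l q.
Proof.
move=> q y.
suff -> : transition_prob X t h i j = mixed_coef i j y q.
  case: eqP => [->|_]; last by rewrite mixed_coefE.
  by rewrite mixed_coef0.
have Xti_gt0 : 0 < fine (P (X t @^-1` [set i])).
  rewrite (INAR1_marginal_pmf t i halpha hmu hX hX0).
  have mu1 : 0 < 1 + mu by lra.
  by rewrite mulr_gt0 ?exprn_gt0 ?invr_gt0 ?subr_gt0 ?invf_lt1 ?ltrDl.
(* h >= 1 makes alpha^h < 1, hence q < 1, as the series expansion requires. *)
have ah01 : 0 < alpha ^+ h < 1.
  by case/andP: halpha => a0 a1; rewrite exprn_gt0// exprn_ilt1 ?ltW// -lt0n.
rewrite /transition_prob /cond_prob setIC.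
(* Clearing the denominator leaves joint probabilities, to be compared as coefficients of power
   series in s with t, h and i fixed. *)
apply: (mulIf (lt0r_neq0 Xti_gt0)); rewrite divfK ?gt_eqF// [RHS]mulrC.
have m1 : 0 < (1 - alpha ^+ h) * mu.
  by case/andP: ah01 => a0 a1; rewrite mulr_gt0// subr_gt0.
have q01 : 0 < q < 1.
  have m2 : 0 < 1 + (1 - alpha ^+ h) * mu by lra.
  by rewrite /q /q_par invr_gt0 m2 invf_lt1// ltrDl.
apply: (@power_series_unique _
  (fun j => fine (P (X t @^-1` [set i] `&` X (t + h)%N @^-1` [set j])))
  (fun j => fine (P (X t @^-1` [set i])) * mixed_coef i j y q)
  (fun s => fine (P (X t @^-1` [set i])) *
    (thinning_pgf (alpha ^+ h) mu s ^+ i *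
     (1 + (1 - alpha ^+ h) * mu * (1 - s))^-1))) => s s01.
- have /andP[s0 s1] := s01.
  apply: cvg_series_pmf; [exact: measurable_nat_preimage|exact: ltW|].
  rewrite (INAR1_joint_pgf halpha hmu hX) ?(ltW s0)// [RHS]EFinM fineK//.
  rewrite fin_num_measure//.
  exact: measurable_nat_preimage.
- rewrite (_ : series _ = fun n => fine (P (X t @^-1` [set i])) *
    series (fun j => mixed_coef i j y q * s ^+ j) n); last first.
    apply/funext => n; rewrite !seriesEnat/= mulr_sumr; apply: eq_bigr => k _.
    by rewrite mulrA.
  apply: cvgM; first exact: cvg_cst.
  have vpos : 0 < 1 + (1 - alpha ^+ h) * mu * (1 - s) by nra.
  rewrite (_ : _ * _^-1 = (1 - y + y * (q * s / (1 - (1 - q) * s))) ^+ i *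
    (q / (1 - (1 - q) * s))); first exact: cvg_series_mixed_coef.
  (* With a = alpha^h, 1 - q = (1 - a) mu q, so 1 - (1 - q) s = q (1 + (1 - a) mu (1 - s)); both
     factors then agree as rational functions. *)
  move: m1 vpos; rewrite /thinning_pgf /y /q /q_par; move: (alpha ^+ h) => a m1 vpos.
  by congr (_ ^+ _ * _); field; rewrite !gt_eqF//; lra.
Qed.
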